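(* Let $M$ be a seven-dimensional manifold with a $GL(2,\mathbb{R})$ structure, let $$I_0=\theta^1\theta^7-6\,\theta^2\theta^6+15\,\theta^3\theta^5-10\,(\theta^4)^2$$ be the associated quadratic form (representing the induced conformal structure), and let $\phi$ be the three-form $$\phi(X,Y,Z)=c\,\langle\langle X,Y\rangle_3,Z\rangle_6,\qquad c=\sqrt{5/2},$$ where tangent vectors are identified with homogeneous sextic polynomials and $\langle\cdot,\cdot\rangle_p$ is the $p$-th transvectant. Then $\phi$ is compatible with the conformal structure $I_0$: a vector $V$ is null with respect to $I_0$ if and only if $$(V\lrcorner\,\phi)\wedge(V\lrcorner\,\phi)\wedge\phi=0,$$ where $(V\lrcorner\,\phi)(X,Y):=\phi(V,X,Y)$.
   Context: A $GL(2,\mathbb{R})$ structure on a smooth seven-dimensional manifold $M$ is a smooth bundle isomorphism $TM\cong S^6(\mathbb{S})$ with $\mathbb{S}\to M$ a real rank-two vector bundle. It is locally specified by a binary sextic with values in $T^*M$, $Q(X_1,X_2)=\sum_{i=0}^6\binom{6}{i}\theta^{i+1}(X_1)^i(X_2)^{6-i}$, where $\theta^1,\dots,\theta^7$ are linearly independent one-forms. A tangent vector $V=\sum_i v^i\theta_i$ (with $(\theta_i)$ dual to $(\theta^i)$) is identified with the polynomial $\sum_{i=0}^6\binom{6}{i}v^{i+1}(X_1)^i(X_2)^{6-i}$. For homogeneous polynomials $Q$ of degree $n$ and $R$ of degree $m$ in $(X_1,X_2)$, the $p$-th transvectant is the homogeneous polynomial of degree $n+m-2p$ $$\langle Q,R\rangle_p=\frac{1}{p!}\sum_{i=0}^p\binom{p}{i}(-1)^i\frac{\partial^pQ}{\partial(X_1)^{p-i}\partial(X_2)^i}\,\frac{\partial^pR}{\partial(X_1)^i\partial(X_2)^{p-i}}.$$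 *)

(* Defs.v *)
From HB Require Import structures.
From mathcomp Require Import all_boot all_order all_fingroup all_algebra.
From mathcomp Require Import all_classical all_reals all_analysis.
(* The notations of mpoly clash with those of the analysis library. *)
From mathcomp Require Import -(notations) mpoly.

Set Implicit Arguments.
Unset Strict Implicit.
Unset Printing Implicit Defensive.

Import Order.TTheory GRing.Theory Num.Theory.
Import numFieldNormedType.Exports.
Local Open Scope classical_set_scope.
Local Open Scope ring_scope.

(* Meant for finite-dimensional V and open U, where requiring directional
   derivatives to be C^k in every fixed direction v gives the usual C^(k+1). *)
Fixpoint Ck (R : realType) (V W : normedModType R) (k : nat) (U : set V)
    (f : V -> W) : Prop :=
  if k is k'.+1 then
    (forall x, U x -> differentiable f x) /\
    (forall v : V, Ck k' U (fun x => 'D_v f x))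
  else forall x, U x -> {for x, continuous f}.

Definition smooth (R : realType) (V W : normedModType R) (U : set V)
    (f : V -> W) : Prop := forall k, Ck k U f.

Record manifold (R : realType) (n : nat) := Manifold {
  carrier :> topologicalType;
  manifold_hausdorff : hausdorff_space carrier;
  manifold_second_countable : @second_countable carrier;
  chart_index : Type;
  chart_dom : chart_index -> set carrier;
  chart : chart_index -> carrier -> 'rV[R]_n;
  chart_inv : chart_index -> 'rV[R]_n -> carrier;
  chart_cover : forall x, exists i, chart_dom i x;
  chart_dom_open : forall i, open (chart_dom i);
  chart_img_open : forall i, open (chart i @` chart_dom i);
  chartK : forall i x, chart_dom i x -> chart_inv i (chart i x) = x;
  chart_continuous : forall i x, chart_dom i x -> {for x, continuous (chart i)};
  chart_inv_continuous : forall i y,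
    (chart i @` chart_dom i) y -> {for y, continuous (chart_inv i)};
  chart_change_smooth : forall i j,
    smooth (chart i @` (chart_dom i `&` chart_dom j)) (chart j \o chart_inv i)
}.

Section Manifold.
Variables (R : realType) (n : nat) (M : manifold R n).

Definition smooth_fun (W : normedModType R) (U : set M) (f : M -> W) : Prop :=
  forall i : chart_index M,
    smooth (chart i @` (U `&` chart_dom i)) (f \o chart_inv i).

(* A tangent vector at x is the family of its coordinate vectors in all charts
   around x, related by the differentials of the chart changes; the entries at
   charts whose domain does not contain x are normalised to 0. *)
Definition tangent_pred (x : M) : {pred chart_index M -> 'rV[R]_n} :=
  fun v => `[< (forall i j, chart_dom i x -> chart_dom j x ->
                  v j = 'd (chart j \o chart_inv i) (chart i x) (v i)) /\
               (forall i, ~ chart_dom i x -> v i = 0) >].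

Lemma tangent_submod_closed (x : M) : submod_closed (tangent_pred x).
Proof.
split=> [|c u v /asboolP[u1 u2] /asboolP[v1 v2]]; apply/asboolP; split.
- by move=> i j _ _; rewrite linear0.
- by [].
- move=> i j xi xj; rewrite linearP -u1// -v1//.
- by move=> i xi; rewrite /GRing.add/= /GRing.scale/= u2// v2// scaler0 addr0.
Qed.

HB.instance Definition _ (x : M) :=
  GRing.isSubmodClosed.Build R (chart_index M -> 'rV[R]_n) (tangent_pred x)
    (tangent_submod_closed x).

Record tangent (x : M) := Tangent {
  tangent_coord :> chart_index M -> 'rV[R]_n;
  tangentP : tangent_coord \in tangent_pred x }.

HB.instance Definition _ (x : M) := [isSub for @tangent_coord x].
HB.instance Definition _ (x : M) := [Choice of tangent x by <:].
HB.instance Definition _ (x : M) :=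
  [SubChoice_isSubLmodule of tangent x by <:].

(* In each chart i, th = \sum_k a_k dx^k with smooth coefficients a_k. *)
Definition smooth_one_form (U : set M)
    (th : forall x : M, {scalar (tangent x)}) : Prop :=
  forall i : chart_index M, exists a : 'I_n -> M -> R,
    (forall k, smooth_fun (U `&` chart_dom i) (a k)) /\
    (forall x, (U `&` chart_dom i) x -> forall V : tangent x,
       th x V = \sum_(k < n) a k x * V i ord0 k).

End Manifold.

Section BinaryForms.
Variable R : realType.

Definition X1 : mpoly 2 R := mpolyX R (mnm1 ord0).
Definition X2 : mpoly 2 R := mpolyX R (mnm1 ord_max).

(* \partial^(a + b) P / \partial X1^a \partial X2^b *)
Definition partial (a b : nat) (P : mpoly 2 R) : mpoly 2 R :=
  iter a (mderiv ord0) (iter b (mderiv ord_max) P).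

Definition transvectant (p : nat) (P Q : mpoly 2 R) : mpoly 2 R :=
  (p`!%:R)^-1 *:
    \sum_(i < p.+1) ('C(p, i)%:R * (-1) ^+ i) *:
       (partial (p - i) i P * partial i (p - i) Q).

(* Indices are shifted by one: v i is the coefficient written v^(i+1). *)
Definition sextic (v : 'I_7 -> R) : mpoly 2 R :=
  \sum_(i < 7) ('C(6, i)%:R * v i) *: (X1 ^+ i * X2 ^+ (6 - i)).

(* P(X) |-> P(g X), X being the column vector of X1 and X2. *)
Definition subst_form (g : 'M[R]_2) (P : mpoly 2 R) : mpoly 2 R :=
  comp_mpoly
    [tuple g i ord0 *: X1 + g i ord_max *: X2 | i < 2] P.

End BinaryForms.

Section Forms.
Variables (R : realType) (T : lmodType R).

(* A k-form is represented by its values on k-tuples of vectors. *)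
Definition kform (k : nat) := ('I_k -> T) -> R.

(* (a /\ b)(v_1, ..., v_(k+l)) is 1/(k! l!) times the sum over permutations s
   of sgn(s) a(v_s(1), ..., v_s(k)) b(v_s(k+1), ..., v_s(k+l)). *)
Definition exterior_product (k l : nat) (a : kform k) (b : kform l) :
    kform (k + l) :=
  fun v => (k`!%:R * l`!%:R)^-1 *
    \sum_(s : 'S_(k + l)) (-1) ^+ s *
       (a (fun i => v (s (lshift l i))) * b (fun j => v (s (rshift k j)))).

Definition interior_product (k : nat) (V : T) (a : kform k.+1) : kform k :=
  fun v => a (fun i => if unlift ord0 i is Some j then v j else V).

End Forms.

(* The rank-two bundle S is given by local frames (X1^a, X2^a) over the open
   sets gl2_dom a, with X^a = gl2_change a b . X^b on overlaps.  A fibre of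
   S^6(S) over gl2_dom a thus consists of the binary sextics in X^a, and the
   bundle isomorphism TM ~ S^6(S) is, over gl2_dom a, the map
   V |-> sextic (th^1(V), ..., th^7(V)) for a smooth coframe th; gl2_compat
   says that these local maps agree on overlaps.  The coframe gl2_coframe a
   and the matrices gl2_change a b carry no information outside gl2_dom a,
   respectively gl2_dom a `&` gl2_dom b. *)
Record GL2_structure (R : realType) (M : manifold R 7) := GL2Structure {
  gl2_index : Type;
  gl2_dom : gl2_index -> set M;
  gl2_dom_open : forall a, open (gl2_dom a);
  gl2_cover : forall x, exists a, gl2_dom a x;
  gl2_coframe : gl2_index -> 'I_7 -> forall x : M, {scalar (tangent x)};
  gl2_coframe_smooth : forall a k,
    smooth_one_form (gl2_dom a) (gl2_coframe a k);
  gl2_coframe_free : forall a x, gl2_dom a x -> forall c : 'I_7 -> R,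
    (forall V : tangent x, \sum_(k < 7) c k * gl2_coframe a k x V = 0) ->
    forall k, c k = 0;
  gl2_change : gl2_index -> gl2_index -> M -> 'M[R]_2;
  gl2_change_unit : forall a b x, gl2_dom a x -> gl2_dom b x ->
    gl2_change a b x \in unitmx;
  gl2_change_smooth : forall a b,
    smooth_fun (gl2_dom a `&` gl2_dom b) (gl2_change a b);
  gl2_cocycle : forall a b c x, gl2_dom a x -> gl2_dom b x -> gl2_dom c x ->
    gl2_change a c x = gl2_change a b x *m gl2_change b c x;
  gl2_compat : forall a b x, gl2_dom a x -> gl2_dom b x ->
    forall V : tangent x,
      sextic (fun k => gl2_coframe b k x V) =
      subst_form (gl2_change a b x) (sextic (fun k => gl2_coframe a k x V))
}.

Section GL2Forms.
Variables (R : realType) (M : manifold R 7) (G : GL2_structure M).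
Variables (a : gl2_index G) (x : M).

Definition tangent_sextic (V : tangent x) : mpoly 2 R :=
  sextic (fun k => gl2_coframe a k x V).

(* I0 and phi are taken in the coframe of the frame domain a: another frame
   multiplies each of them by a nonzero power of det (gl2_change). *)
Definition I0 (V : tangent x) : R :=
  let th k := gl2_coframe a (inord k.-1) x V in
  th 1%N * th 7%N - 6 * (th 2%N * th 6%N) + 15 * (th 3%N * th 5%N)
    - 10 * th 4%N ^+ 2.

(* <<X, Y>_3, Z>_6 has degree 0: its value is its constant coefficient. *)
Definition phi : kform (tangent x) 3 := fun X =>
  Num.sqrt (5 / 2) *
  mcoeff mnm0
    (transvectant 6
       (transvectant 3 (tangent_sextic (X 0)) (tangent_sextic (X 1)))
       (tangent_sextic (X 2))).

End GL2Forms.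

Arguments phi {R M G} a x.

(* Main.v *)
Require Import Defs.
From HB Require Import structures.
From mathcomp Require Import all_boot all_order all_fingroup all_algebra.
From mathcomp Require Import all_classical all_reals all_analysis.
From mathcomp Require Import ring.
From mathcomp Require Import -(notations) mpoly.

Set Implicit Arguments.
Unset Strict Implicit.
Unset Printing Implicit Defensive.

Import Order.TTheory GRing.Theory Num.Theory.
Local Open Scope ring_scope.

(** Write e^0, ..., e^6 for the coframe (theta^1, ..., theta^7, shifted) and
    e^(ijk) for a wedge product.  The seven-form
    (V _| phi) /\ (V _| phi) /\ phi depends quadratically and
    SL(2)-equivariantly on V, and the sextics carry only one invariant
    quadratic form up to scale, so it has to be a multiple of I0(V) times the
    volume form.  What has to be excluded is that the factor vanishes; this is
    a computation, and the computation proves the proportionality as well: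

      (V _| phi) /\ (V _| phi) /\ phi = - 54 K^3 I0(V) e^0 /\ ... /\ e^6

    with K = sqrt(5/2) * 2400 * 720 (lemma [exterior_phi]).

    Two ingredients give this identity.  First, evaluating the transvectants
    shows that phi is K times
    - e^036 + 3 e^045 + 3 e^126 - 6 e^135 + 15 e^234
    ([phi_sextic]); the index triples are those of total weight zero, i + j + k
    = 9.  Derivatives of binary forms are transparent in the normalisation
    with binomial coefficients, where they only shift the coefficient sequence;
    for this reason binary forms are built by the recursion [bform].  Second,
    wedge products of coframe elements multiply by concatenating their lists of
    indices ([exterior_product_simple], a form of Laplace expansion), and a
    wedge product of seven of them is the volume form up to the sign of the
    list of indices ([simple_form_sign]).  Expanding the three factors thus
    leaves a sum of 15 * 15 * 5 signed integer coefficients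
    ([sum_wedge_terms]).

    If I0(V) = 0 the seven-form vanishes.  Conversely, linear independence of
    the coframe yields seven tangent vectors on which the volume form does not
    vanish ([free_det_neq0]), so that the vanishing of the seven-form forces
    I0(V) = 0. *)

(** * Binary forms and their transvectants *)

Section BinaryForms.
Variable R : realType.
Implicit Types (u v w : nat -> R).

(** The binary form with coefficients 'C(n, i) v_i on X1^i X2^(n - i), built by
    Pascal's rule: both partial derivatives commute with this recursion, which
    makes the derivative formulas below immediate inductions. *)
Fixpoint bform (n : nat) v : mpoly 2 R :=
  if n is n'.+1 then X1 R * bform n' (v \o succn) + X2 R * bform n' v
  else mpolyC 2 (v 0%N).

Lemma bform_ext n u v : (forall i, (i <= n)%N -> u i = v i) ->
  bform n u = bform n v.
Proof.
elim: n u v => [|n IHn] u v uv /=; first by rewrite uv.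
congr (_ * _ + _ * _); apply: IHn => i i_le /=; apply: uv => //.
exact: leqW.
Qed.

Lemma bform_sum n m (c : 'I_m -> R) (f : 'I_m -> nat -> R) :
  \sum_(i < m) c i *: bform n (f i) =
  bform n (fun k => \sum_(i < m) c i * f i k).
Proof.
elim: n f => [|n IHn] f /=.
  rewrite rmorph_sum/=; apply: eq_bigr => i _.
  by rewrite rmorphM/= mul_mpolyC.
rewrite -(IHn f) -(IHn (fun i => f i \o succn)) !mulr_sumr -big_split/=.
by apply: eq_bigr => i _; rewrite scalerDr -!scalerAr.
Qed.

Lemma scale_bform n c v : c *: bform n v = bform n (fun k => c * v k).
Proof.
elim: n v => [|n IHn] v /=; first by rewrite -mul_mpolyC rmorphM.
by rewrite scalerDr !scalerAr !IHn.
Qed.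

Lemma scale_natE n (p : mpoly 2 R) : n%:R *: p = n%:R * p.
Proof. by rewrite -mul_mpolyC rmorph_nat. Qed.

Lemma mderiv0_X1 : mderiv ord0 (X1 R) = 1.
Proof.
rewrite mderivX mnm1E eqxx scale1r -mpolyX0; congr (mpolyX _ _).
by apply/mnmP => i; rewrite mnmBE subnn mnm0E.
Qed.

Lemma mderiv1_X1 : mderiv ord_max (X1 R) = 0.
Proof. by rewrite mderivX mnm1E scale0r. Qed.

Lemma mderiv0_X2 : mderiv ord0 (X2 R) = 0.
Proof. by rewrite mderivX mnm1E scale0r. Qed.

Lemma mderiv1_X2 : mderiv ord_max (X2 R) = 1.
Proof.
rewrite mderivX mnm1E eqxx scale1r -mpolyX0; congr (mpolyX _ _).
by apply/mnmP => i; rewrite mnmBE subnn mnm0E.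
Qed.

Lemma mderiv0_bform n v :
  mderiv ord0 (bform n v) = n%:R *: bform n.-1 (v \o succn).
Proof.
elim: n v => [|n IHn] v /=; first by rewrite mderivC scale0r.
rewrite scale_natE mderivD !mderivM mderiv0_X1 mderiv0_X2 !IHn !scale_natE.
by case: n {IHn} => [|n] /=; ring.
Qed.

Lemma mderiv1_bform n v :
  mderiv ord_max (bform n v) = n%:R *: bform n.-1 v.
Proof.
elim: n v => [|n IHn] v /=; first by rewrite mderivC scale0r.
rewrite scale_natE mderivD !mderivM mderiv1_X1 mderiv1_X2 !IHn !scale_natE.
by case: n {IHn} => [|n] /=; ring.
Qed.

Lemma iter_mderiv0_bform a n v :
  iter a (mderiv ord0) (bform (n + a) v) =
  ((n + a) ^_ a)%:R *: bform n (fun k => v (k + a)%N).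
Proof.
elim: a n v => [|a IHa] n v.
  by rewrite scale1r addn0; apply: bform_ext => i _; rewrite addn0.
rewrite iterS -addSnnS IHa mderivZ mderiv0_bform scalerA.
rewrite -natrM addSnnS ffactnSr -addSnnS addnK.
by congr (_ *: _); apply: bform_ext => i _ /=; rewrite addSnnS.
Qed.

Lemma iter_mderiv1_bform a n v :
  iter a (mderiv ord_max) (bform (n + a) v) =
  ((n + a) ^_ a)%:R *: bform n v.
Proof.
elim: a n v => [|a IHa] n v; first by rewrite scale1r addn0.
rewrite iterS -addSnnS IHa mderivZ mderiv1_bform scalerA.
by rewrite -natrM addSnnS ffactnSr -addSnnS addnK.
Qed.

Lemma partial_bform n p a b v : (a + b = p)%N ->
  partial a b (bform (n + p) v) =
  ((n + p) ^_ p)%:R *: bform n (fun k => v (k + a)%N).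
Proof.
move=> <-; rewrite /partial addnA iter_mderiv1_bform.
have iterZ c q :
    iter a (mderiv ord0) (c *: q) = c *: iter a (@mderiv 2 R ord0) q.
  by elim: a => //= a ->; rewrite mderivZ.
rewrite iterZ iter_mderiv0_bform scalerA -natrM; congr (_%:R *: _).
have ffactD m k : ((m + k) ^_ k * m`! = (m + k)`!)%N.
  by rewrite -{2}(addnK k m) ffact_fact ?leq_addl.
by apply/eqP; rewrite -(eqn_pmul2r (fact_gt0 n)) -mulnA !ffactD -addnA ffactD.
Qed.

(** Used below to unroll sums of fixed length into explicit expressions. *)
Lemma sum_ord_seq (A : nmodType) n (F : nat -> A) :
  \sum_(i < n) F i = \sum_(i <- iota 0 n) F i.
Proof. by rewrite -(big_mkord xpredT) /index_iota subn0. Qed.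

Lemma bin3E : ('C(3, 0) = 1)%N * ('C(3, 1) = 3)%N * ('C(3, 2) = 3)%N *
  ('C(3, 3) = 1)%N * ('C(3, 4) = 0)%N * ('C(3, 5) = 0)%N * ('C(3, 6) = 0)%N.
Proof. by []. Qed.

Lemma bin6E : ('C(6, 0) = 1)%N * ('C(6, 1) = 6)%N * ('C(6, 2) = 15)%N *
  ('C(6, 3) = 20)%N * ('C(6, 4) = 15)%N * ('C(6, 5) = 6)%N * ('C(6, 6) = 1)%N.
Proof. by []. Qed.

Lemma bform6_monomials v :
  bform 6 v =
  \sum_(k < 7) ('C(6, k)%:R * v k) *: (X1 R ^+ k * X2 R ^+ (6 - k)).
Proof.
under eq_bigr do rewrite -mul_mpolyC rmorphM rmorph_nat/=.
rewrite (sum_ord_seq _ (fun k =>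
  'C(6, k)%:R * mpolyC 2 (v k) * (X1 R ^+ k * X2 R ^+ (6 - k)))).
rewrite !big_cons big_nil !bin6E !(subSS, subn0) /=.
ring.
Qed.

Lemma sexticE (v : 'I_7 -> R) :
  sextic v = bform 6 (fun k => v (inord k)).
Proof.
by rewrite bform6_monomials; apply: eq_bigr => i _; rewrite inord_val.
Qed.

Lemma bform3M v w : bform 3 v * bform 3 w =
  bform 6 (fun k => 'C(6, k)%:R^-1 * \sum_(i < k.+1)
    'C(3, i)%:R * 'C(3, k - i)%:R * (v i * w (k - i)%N)).
Proof.
rewrite bform6_monomials.
under eq_bigr => k _.
  rewrite mulVKf ?pnatr_eq0 -?lt0n ?bin_gt0 -1?ltnS// -mul_mpolyC.
  rewrite (sum_ord_seq _ (fun i =>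
    'C(3, i)%:R * 'C(3, k - i)%:R * (v i * w (k - i)%N))).
  over.
rewrite (sum_ord_seq _ (fun k => mpolyC 2 (\sum_(i <- iota 0 k.+1)
  'C(3, i)%:R * 'C(3, k - i)%:R * (v i * w (k - i)%N)) *
  (X1 R ^+ k * X2 R ^+ (6 - k)))).
rewrite !(big_cons, big_nil) !(subSS, subn0, sub0n) !bin3E.
rewrite !(rmorphD, rmorphM) /= !(rmorph0, rmorph1, rmorph_nat).
ring.
Qed.

Lemma transvectant_bform n p v w :
  transvectant p (bform (n + p) v) (bform (n + p) w) =
  (((n + p) ^_ p)%:R ^+ 2 / p`!%:R) *:
    \sum_(i < p.+1) ('C(p, i)%:R * (-1) ^+ i) *:
      (bform n (fun k => v (k + (p - i))%N) * bform n (fun k => w (k + i)%N)).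
Proof.
rewrite /transvectant [_ / _]mulrC -scalerA; congr (_ *: _).
rewrite scaler_sumr; apply: eq_bigr => i _.
have ip : (i <= p)%N by rewrite -ltnS.
rewrite (partial_bform _ _ (subnK ip)) (partial_bform _ _ (subnKC ip)).
by rewrite -scalerAl -scalerAr !scalerA expr2 -mulrA mulrC mulrA.
Qed.

(** The factor 2400 is 120 ^ 2 / 3!, each third derivative of a sextic
    contributing 6 * 5 * 4 = 120. *)
Definition transvectant3_coef v w k : R :=
  2400 * \sum_(i <- iota 0 4) ('C(3, i)%:R * (-1) ^+ i) *
    ('C(6, k)%:R^-1 * \sum_(j <- iota 0 k.+1)
      'C(3, j)%:R * 'C(3, k - j)%:R * (v (j + (3 - i))%N * w (k - j + i)%N)).

Lemma transvectant3_sextic v w :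
  transvectant 3 (bform 6 v) (bform 6 w) = bform 6 (transvectant3_coef v w).
Proof.
rewrite (transvectant_bform 3 3) -scale_bform; congr (_ *: _).
  by rewrite (_ : (3 + 3) ^_ 3 = 120)%N// (_ : 3`! = 6)%N//; field.
under eq_bigr do rewrite bform3M.
rewrite bform_sum; apply: bform_ext => k _.
pose term i j := 'C(3, j)%:R * 'C(3, k - j)%:R *
  (v (j + (3 - i))%N * w (k - j + i)%N).
rewrite -(sum_ord_seq _ (fun i => ('C(3, i)%:R * (-1) ^+ i) *
  ('C(6, k)%:R^-1 * \sum_(j <- iota 0 k.+1) term i j))).
apply: eq_bigr => i _; congr (_ * (_ * _)).
exact: (sum_ord_seq _ (term i)).
Qed.

Lemma transvectant6_sextic v w :
  mcoeff mnm0 (transvectant 6 (bform 6 v) (bform 6 w)) =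
  720 * \sum_(i <- iota 0 7) 'C(6, i)%:R * (-1) ^+ i * (v (6 - i)%N * w i).
Proof.
rewrite (transvectant_bform 0 6) mcoeffZ; congr (_ * _).
  by rewrite (_ : (0 + 6) ^_ 6 = 720)%N// (_ : 6`! = 720)%N//; field.
rewrite (big_morph _ (mcoeffD _) (mcoeff0 _ _)).
rewrite -(sum_ord_seq _ (fun i =>
  'C(6, i)%:R * (-1) ^+ i * (v (6 - i)%N * w i))).
apply: eq_bigr => i _.
by rewrite mcoeffZ /= !add0n -rmorphM mpolyCK.
Qed.

Definition minor3 u v w i j k : R :=
  u i * (v j * w k - v k * w j) - u j * (v i * w k - v k * w i)
  + u k * (v i * w j - v j * w i).

(** The trilinear form << u, v >_3, w >_6 is alternating, and invariance under
    the diagonal torus leaves only the index triples with sum 9. *)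
Lemma phi_sextic u v w :
  mcoeff mnm0 (transvectant 6
    (transvectant 3 (bform 6 u) (bform 6 v)) (bform 6 w)) =
  2400 * 720 *
    (- minor3 u v w 0 3 6 + 3 * minor3 u v w 0 4 5 + 3 * minor3 u v w 1 2 6
     - 6 * minor3 u v w 1 3 5 + 15 * minor3 u v w 2 3 4).
Proof.
rewrite transvectant3_sextic transvectant6_sextic.
rewrite [2400 * _]mulrC -mulrA; congr (_ * _).
rewrite !(big_cons, big_nil) /transvectant3_coef !(subSS, subn0).
rewrite !(big_cons, big_nil).
cbv [addn subn Nat.add Nat.sub].
rewrite !bin3E !bin6E /minor3.
by field.
Qed.

End BinaryForms.

(** * Wedge products of one-forms *)

(** The alternating sum over all permutations s, in which both minors are
    expanded over permutations t and u, becomes for each pair (t, u) the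
    determinant of the stacked matrix with its row blocks permuted by t and u;
    the signs cancel, so the k! l! pairs contribute equally. *)
Lemma laplace_col_mx (R : comNzRingType) k l
    (F : 'M[R]_(k, k + l)) (G : 'M[R]_(l, k + l)) :
  \sum_(s : 'S_(k + l)) (-1) ^+ s *
    (\det (\matrix_(i, j) F i (s (lshift l j))) *
     \det (\matrix_(i, j) G i (s (rshift k j)))) =
  k`!%:R * l`!%:R * \det (col_mx F G).
Proof.
have detE n (A : 'M[R]_n) :
    \det A = \sum_(t : 'S_n) (-1) ^+ t * \prod_i A (t i) i.
  by rewrite -det_tr; apply: eq_bigr => t _; under eq_bigr do rewrite mxE.
under eq_bigr => s _.
  rewrite !detE mulr_suml mulr_sumr.
  under eq_bigr => t _ do rewrite mulr_sumr mulr_sumr.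
  over.
rewrite exchange_big /=.
under eq_bigr => t _ do rewrite exchange_big /=.
transitivity (\sum_(t : 'S_k) \sum_(u : 'S_l) \det (col_mx F G)); last first.
  by rewrite !sumr_const !card_Sn -mulrnA mulnC -natrM mulr_natl.
apply: eq_bigr => t _; apply: eq_bigr => u _.
have -> : \det (col_mx F G) =
    (-1) ^+ t * (-1) ^+ u * \det (col_mx (row_perm t F) (row_perm u G)).
  rewrite !row_permE.
  have -> : col_mx (perm_mx t *m F) (perm_mx u *m G) =
      block_mx (perm_mx t) 0 0 (perm_mx u) *m col_mx F G.
    by rewrite mul_block_col !mul0mx addr0 add0r.
  rewrite det_mulmx det_ublock !det_perm !mulrA -!signr_addb.
  by case: (odd_perm t); case: (odd_perm u); rewrite expr0 mul1r.
rewrite [\det _]/determinant mulr_sumr; apply: eq_bigr => s _.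
rewrite big_split_ord /=.
under [in RHS]eq_bigr do rewrite col_mxEu mxE.
under [X in _ = _ * (_ * (_ * X))]eq_bigr do rewrite col_mxEd mxE.
under eq_bigr do rewrite !mxE.
under [X in _ * (_ * (_ * X)) = _]eq_bigr do rewrite !mxE.
by rewrite mulrACA [RHS]mulrCA.
Qed.

Section SimpleForms.
Variables (R : realType) (T : lmodType R) (e : nat -> T -> R).

(** The wedge product e^(m_0) /\ ... /\ e^(m_(k-1)) of one-forms. *)
Definition simple_form k (m : seq nat) : kform T k :=
  fun v => \det (\matrix_(i < k, j < k) e (nth 0%N m i) (v j)).

Lemma exterior_product_simple k l m1 m2 : size m1 = k ->
  exterior_product (@simple_form k m1) (@simple_form l m2) =
  @simple_form (k + l) (m1 ++ m2).
Proof.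
move=> sz; apply: funext => v; rewrite /exterior_product.
pose F := \matrix_(i < k, j < k + l) e (nth 0%N m1 i) (v j).
pose G := \matrix_(i < l, j < k + l) e (nth 0%N m2 i) (v j).
transitivity (\det (col_mx F G)).
  transitivity ((k`!%:R * l`!%:R)^-1 *
      (k`!%:R * l`!%:R * \det (col_mx F G))).
    congr (_ * _); rewrite -laplace_col_mx /simple_form.
    apply: eq_bigr => s _; congr (_ * _).
    by congr (_ * _); congr (\det _); apply/matrixP => i j; rewrite !mxE.
  by rewrite mulKf// mulf_neq0// pnatr_eq0 -lt0n fact_gt0.
congr (\det _); apply/matrixP => i j; rewrite [RHS]mxE.
case: (split_ordP i) => i' ->; rewrite ?col_mxEu ?col_mxEd mxE nth_cat sz /=.
  by rewrite ltn_ord.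
by rewrite ltnNge leq_addr /= addKn.
Qed.

(** Indexing the result by a list of pairs lets the lemma apply again to a
    product of three factors. *)
Lemma exterior_product_sum (I J : Type) (r : seq I) (q : seq J) k l
    (a : I -> R) (b : J -> R) (A : I -> kform T k) (B : J -> kform T l) :
  exterior_product (fun v => \sum_(x <- r) a x * A x v)
                   (fun v => \sum_(y <- q) b y * B y v) =
  (fun v => \sum_(p <- [seq (x, y) | x <- r, y <- q])
     a p.1 * b p.2 * exterior_product (A p.1) (B p.2) v).
Proof.
apply: funext => v; rewrite big_allpairs /exterior_product.
under [X in _ * X = _]eq_bigr => s _.
  rewrite mulr_suml mulr_sumr.
  under eq_bigr => x _ do rewrite !mulr_sumr.
  over.
rewrite exchange_big mulr_sumr /=; apply: eq_bigr => x _.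
rewrite exchange_big mulr_sumr /=; apply: eq_bigr => y _.
rewrite [RHS]mulrCA; congr (_ * _); rewrite mulr_sumr; apply: eq_bigr => s _.
by rewrite mulrACA [RHS]mulrCA.
Qed.

End SimpleForms.

(** The sign of a list m of length n as a permutation of 0, ..., n - 1, and 0
    if m is not one.  The recursion is the expansion along the first row of the
    matrix whose i-th row is the basis vector with index m_i, read as the zero
    row when m_i >= n.  A later entry equal to x loses its only nonzero column
    and is sent to n', which is out of range for the minor. *)
Fixpoint seq_sign n (m : seq nat) : int :=
  if n is n'.+1 then
    let x := head 0%N m in
    if (x <= n')%N then
      (-1) ^+ x *
      seq_sign n' [seq if y == x then n' else unbump x y | y <- behead m]
    else 0
  else 1.

Lemma seq_sign_det (R : comNzRingType) n (m : seq nat) : size m = n ->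
  \det (\matrix_(i < n, j < n) ((nth 0%N m i == j)%:R : R)) =
  (seq_sign n m)%:~R.
Proof.
elim: n m => [|n IHn] m sz /=; first by rewrite det_mx00.
case: m sz => [//|x m] [sz] /=; rewrite (expand_det_row _ ord0).
case: leqP => xn; last first.
  rewrite big1// => j _; rewrite mxE /= gtn_eqF ?mul0r//.
  exact: leq_trans (ltn_ord j) xn.
rewrite (bigD1 (Ordinal (xn : x < n.+1)%N))//= big1 ?addr0 => [|j jx];
    last first.
  rewrite mxE /= eq_sym; move: jx; rewrite -val_eqE => /negPf/= ->.
  by rewrite mul0r.
rewrite mxE /= eqxx mul1r /cofactor add0n intrM rmorphXn rmorphN1.
congr (_ * _). rewrite -IHn ?size_map//; congr (\det _).
apply/matrixP => i j; rewrite !mxE /= (nth_map 0%N) ?sz//.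
rewrite add0n; congr ((_ : bool)%:R).
have [->|yx] := eqVneq (nth 0%N m i) x.
  by rewrite (gtn_eqF (ltn_ord j)) (negPf (neq_bump x j)).
apply/eqP/eqP => [->|<-]; first by rewrite bumpK.
by rewrite unbumpKcond (negPf yx).
Qed.

Lemma simple_form_sign (R : realType) (T : lmodType R) (e : nat -> T -> R)
    n m v : size m = n -> all (gtn n) m ->
  simple_form e m v =
  (seq_sign n m)%:~R * \det (\matrix_(i < n, j < n) e i (v j)).
Proof.
move=> sz /allP m_lt; rewrite -(seq_sign_det R sz) -det_mulmx; congr (\det _).
apply/matrixP => i j; rewrite !mxE.
have mi : (nth 0%N m i < n)%N by apply: m_lt; rewrite mem_nth ?sz.
rewrite (bigD1 (Ordinal mi))//= big1 ?addr0 => [|k ki].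
  by rewrite !mxE eqxx mul1r.
rewrite !mxE eq_sym; move: ki; rewrite -val_eqE => /negPf/= ->.
by rewrite mul0r.
Qed.

(** Linearly independent scalar functions take independent values on suitable
    vectors, whatever the dimension of T.  As long as k < n vectors have been
    chosen, some c annihilates their value rows; independence provides V on
    which the combination c does not vanish, so the value row of V lies outside
    the span of the previous ones. *)
Lemma free_det_neq0 (R : fieldType) (T : lmodType R) n
    (th : 'I_n -> {scalar T}) :
  (forall c : 'I_n -> R, (forall V, \sum_(k < n) c k * th k V = 0) ->
     forall k, c k = 0) ->
  exists W : 'I_n -> T, \det (\matrix_(i, j) th i (W j)) != 0.
Proof.
move=> th_free.
pose A k (W : 'I_k -> T) : 'M[R]_(k, n) := \matrix_(i, j) th j (W i).
suff /(_ n (leqnn n))[W freeW] :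
    forall k, (k <= n)%N -> exists W, row_free (A k W).
  exists W; rewrite -det_tr -unitfE -[_ \is a _]unitmxE -row_free_unit.
  suff <- : A n W = (\matrix_(i, j) th i (W j))^T by [].
  by apply/matrixP => i j; rewrite !mxE.
elim=> [_|k IHk kn].
  by exists (fun _ => 0); apply: inj_row_free => v _; apply/matrixP => ? [].
have [W freeW] := IHk (ltnW kn).
have : cokermx (A k W) != 0.
  by rewrite -mxrank_eq0 mxrank_coker (eqP freeW) -lt0n subn_gt0.
case/matrix0Pn => p [q pq].
pose c := col q (cokermx (A k W)).
have Ac : A k W *m c = 0 by rewrite /c colE mulmxA mulmx_coker mul0mx.
have [V cV] : exists V, \sum_(i < n) c i 0 * th i V != 0.
  apply/not_existsP => cV; move/eqP: pq; apply.
  have := th_free (fun i => c i 0) _ p; rewrite mxE; apply=> V.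
  by apply/eqP/negP => /negP /cV.
pose W' (i : 'I_(1 + k)) := if fintype.split i is inr j then W j else V.
exists W'; have -> : A (1 + k)%N W' = col_mx (\row_j th j V) (A k W).
  apply/matrixP => i j; rewrite !mxE /W'.
  by case: fintype.splitP => i' _; rewrite !mxE.
apply: inj_row_free; rewrite -[k.+1]/(1 + k)%N => v.
rewrite -[v]hsubmxK mul_row_col => vA.
have a0 : lsubmx v = 0.
  (* Pairing with c kills all previous rows and leaves the coefficient of V. *)
  have := congr1 (mulmxr c) vA.
  rewrite /= mulmxDl -!mulmxA Ac mulmx0 addr0 mul0mx.
  rewrite [lsubmx v]mx11_scalar mul_scalar_mx => /matrixP/(_ 0 0)/eqP.
  rewrite !mxE mulf_eq0 => /orP[/eqP -> | ]; first by rewrite raddf0.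
  under eq_bigr do rewrite mxE mulrC.
  by rewrite (negPf cV).
move: vA; rewrite a0 mul0mx add0r => /eqP.
by rewrite mulmx_free_eq0// => /eqP ->; exact: row_mx0.
Qed.

Lemma det_mx2 (R : comNzRingType) (A : 'M[R]_2) :
  \det A = A 0 0 * A 1 1 - A 0 1 * A 1 0.
Proof.
rewrite (expand_det_row _ 0) !big_ord_recl big_ord0 addr0 /cofactor.
rewrite !det_mx11 !mxE.
have -> : lift 0 0 = 1 :> 'I_2 by apply/val_inj.
have -> : lift 1 0 = 0 :> 'I_2 by apply/val_inj.
by rewrite /= expr0 expr1 mul1r mulN1r mulrN.
Qed.

Lemma det_mx3 (R : comNzRingType) (A : 'M[R]_3) :
  \det A = A 0 0 * (A 1 1 * A 2 2 - A 1 2 * A 2 1)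
    - A 0 1 * (A 1 0 * A 2 2 - A 1 2 * A 2 0)
    + A 0 2 * (A 1 0 * A 2 1 - A 1 1 * A 2 0).
Proof.
rewrite (expand_det_row _ 0) !big_ord_recl big_ord0 addr0 /cofactor.
rewrite !det_mx2 !mxE.
have e (i j : 'I_3) : val i = val j -> i = j by exact: val_inj.
rewrite (e (lift 0 0) 1)// (e (lift 0 (lift 0 0)) 2)//.
rewrite (e (lift 0 1) 2)// ?(e (lift ord0 1) 2)// (e (lift 1 0) 0)//.
rewrite (e (lift 1 1) 2)// (e (lift 2 0) 0)// (e (lift 2 1) 1)//.
by rewrite /= expr0 expr1 sqrrN expr1n; ring.
Qed.

(** * The seven-form *)

(** A pair (c, [:: i; j; k]) stands for the summand c e^(ijk) of phi / K. *)
Definition phi_terms : seq (int * seq nat) :=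
  [:: (-1, [:: 0; 3; 6]%N); (3, [:: 0; 4; 5]%N); (3, [:: 1; 2; 6]%N);
      (- 6%:Z, [:: 1; 3; 5]%N); (15, [:: 2; 3; 4]%N)].

(** A triple (c, i, [:: j; k]) stands for the summand c e^i(V) e^(jk) of
    (V _| phi) / K: the interior product is an antiderivation. *)
Definition contraction_terms : seq (int * nat * seq nat) :=
  [seq ((-1) ^+ l * t.1, nth 0%N t.2 l, take l t.2 ++ drop l.+1 t.2)
     | t <- phi_terms, l <- iota 0 3].

(** A pair (c, (i, j)) stands for c e^i(V) e^j(V) times the volume form, the
    wedge product of one summand from each of the three factors. *)
Definition wedge_terms : seq (int * (nat * nat)) :=
  [seq (p.1.1.1.1 * p.1.2.1.1 * p.2.1 *
          seq_sign 7 ((p.1.1.2 ++ p.1.2.2) ++ p.2.2),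
        (p.1.1.1.2, p.1.2.1.2))
     | p <- [seq (q, t) | q <- [seq (x, y) | x <- contraction_terms,
                                             y <- contraction_terms],
                          t <- phi_terms]].

(** Most of the 1125 products repeat an index and vanish; evaluation of the
    integer coefficients leaves a short list before the real variables enter. *)
Lemma sum_wedge_terms (R : comNzRingType) (v : nat -> R) :
  \sum_(p <- wedge_terms) p.1%:~R * (v p.2.1 * v p.2.2) =
  - 54 * (v 0%N * v 6%N - 6 * (v 1%N * v 5%N) + 15 * (v 2%N * v 4%N)
          - 10 * v 3%N ^+ 2).
Proof.
transitivity (\sum_(p <- [seq p <- wedge_terms | p.1 != 0])
    p.1%:~R * (v p.2.1 * v p.2.2)).
  rewrite big_filter [RHS]big_mkcond/=; apply: eq_bigr => p _.
  by case: eqP => // ->; rewrite mul0r.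
set s := [seq _ <- _ | _].
let t := eval vm_compute in s in have -> : s = t by vm_compute.
rewrite !(big_cons, big_nil) /=.
ring.
Qed.

Section SevenForm.
Variables (R : realType) (M : manifold R 7) (G : GL2_structure M).
Variables (a : gl2_index G) (x : M).

Let e (i : nat) : tangent x -> R := gl2_coframe a (inord i) x.
Let K : R := Num.sqrt (5 / 2) * (2400 * 720).

Lemma phiE (X : 'I_3 -> tangent x) : phi a x X =
  K * (- minor3 (e^~ (X 0)) (e^~ (X 1)) (e^~ (X 2)) 0 3 6
    + 3 * minor3 (e^~ (X 0)) (e^~ (X 1)) (e^~ (X 2)) 0 4 5
    + 3 * minor3 (e^~ (X 0)) (e^~ (X 1)) (e^~ (X 2)) 1 2 6
    - 6 * minor3 (e^~ (X 0)) (e^~ (X 1)) (e^~ (X 2)) 1 3 5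
    + 15 * minor3 (e^~ (X 0)) (e^~ (X 1)) (e^~ (X 2)) 2 3 4).
Proof. by rewrite /phi /tangent_sextic !sexticE phi_sextic mulrA. Qed.

Lemma phi_simple_forms : phi a x =
  (fun X => \sum_(t <- phi_terms) (K * t.1%:~R) * simple_form e t.2 X).
Proof.
apply: funext => X; rewrite phiE !(big_cons, big_nil) /=.
rewrite /simple_form !det_mx3 !mxE /= /minor3.
ring.
Qed.

Lemma interior_phi_simple_forms V : interior_product V (phi a x) =
  (fun X => \sum_(t <- contraction_terms)
     (K * t.1.1%:~R * e t.1.2 V) * simple_form e t.2 X).
Proof.
apply: funext => X; rewrite /interior_product phiE unlift_none.
have -> : unlift ord0 (1 : 'I_3) = Some 0.
  by rewrite (_ : 1 = lift ord0 0) ?liftK//; apply: val_inj.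
have -> : unlift ord0 (2 : 'I_3) = Some 1.
  by rewrite (_ : 2 = lift ord0 1) ?liftK//; apply: val_inj.
rewrite !(big_cons, big_nil) /= /simple_form !det_mx2 !mxE /= /minor3.
ring.
Qed.

Lemma exterior_phi V W :
  exterior_product (exterior_product (interior_product V (phi a x))
    (interior_product V (phi a x))) (phi a x) W =
  - 54 * K ^+ 3 * I0 a V * \det (\matrix_(i < 7, j < 7) e i (W j)).
Proof.
rewrite interior_phi_simple_forms phi_simple_forms !exterior_product_sum.
transitivity (\sum_(p <- wedge_terms) p.1%:~R * (e p.2.1 V * e p.2.2 V) *
   (K ^+ 3 * \det (\matrix_(i < 7, j < 7) e i (W j)))); last first.
  by rewrite -mulr_suml (sum_wedge_terms (e^~ V)) /I0 /=; ring.
rewrite big_map; apply: eq_big_seq => p.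
pose wf (p : (int * nat * seq nat) * (int * nat * seq nat) * (int * seq nat)) :=
  [&& size p.1.1.2 == 2%N, size p.1.2.2 == 2%N, size p.2.2 == 3%N &
      all (gtn 7) ((p.1.1.2 ++ p.1.2.2) ++ p.2.2)].
have /allP/(_ p) :
    all wf [seq (q, t) | q <- [seq (x, y) | x <- contraction_terms,
                                            y <- contraction_terms],
                         t <- phi_terms] by vm_compute.
move=> wf_p /wf_p {wf_p} /and4P[/eqP sz1 /eqP sz2 /eqP sz3 lt7].
rewrite (exterior_product_simple _ _ _ sz1).
rewrite exterior_product_simple ?size_cat ?sz1 ?sz2//.
rewrite (@simple_form_sign _ _ _ 7) ?size_cat ?sz1 ?sz2 ?sz3//= !intrM.
ring.
Qed.

End SevenForm.

Theorem proposition4p1 (R : realType) (M : manifold R 7) (G : GL2_structure M)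
    (a : gl2_index G) (x : M) (xa : gl2_dom a x) (V : tangent x) :
  I0 a V = 0 <->
  exterior_product (exterior_product (interior_product V (phi a x)) (interior_product V (phi a x))) (phi a x) = 0.
Proof.
split=> [I0V | /(congr1 (fun w => w _)) wedge0].
  by apply: funext => W; rewrite exterior_phi I0V mulr0 mul0r.
have [W detW] := free_det_neq0 (gl2_coframe_free xa).
have /eqP := wedge0 W; rewrite exterior_phi.
have -> : \matrix_(i, j) gl2_coframe a (inord i) x (W j) =
    \matrix_(i, j) gl2_coframe a i x (W j).
  by apply/matrixP => i j; rewrite !mxE inord_val.
rewrite mulf_eq0 (negPf detW) orbF mulf_eq0 => /orP[|/eqP//].
rewrite mulf_eq0 oppr_eq0 pnatr_eq0 /= expf_eq0 /= !mulf_eq0 !pnatr_eq0 !orbF.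
by rewrite sqrtr_eq0 leNgt divr_gt0// ltr0n.
Qed.
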